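(* Let $s\in X$. For every $k\ge 0$, $$\sum_{w\in W_k}a_s(w)=u_{2k+1}(s)-u_{2k}(s).$$ In particular, for every $N\ge 1$, $$\sum_{k=0}^{N-1}\sum_{w\in W_k}a_s(w)=\sum_{k=0}^{N-1}\bigl(u_{2k+1}(s)-u_{2k}(s)\bigr).$$
   Context: Let $X$ be a set, $m\ge1$ an integer, and $\varphi_1,\dots,\varphi_m:X\to X$ maps. A kernel $J:X\times X\to\mathbb{C}$ is positive definite if $\sum_{\alpha,\beta}\overline{c_\alpha}c_\beta J(s_\alpha,s_\beta)\ge0$ for all finite families $(c_\alpha,s_\alpha)\in\mathbb{C}\times X$; $J_1\le J_2$ means that $J_2-J_1$ is positive definite. The pullback operator is $(LJ)(s,t):=\sum_{i=1}^m J(\varphi_i(s),\varphi_i(t))$. Fix a positive definite kernel $K$ on $X$ with $LK\ge K$. Set $K_0:=K$, $K_{n+1}:=LK_n$ for $n\ge0$, and $u_n(s):=K_n(s,s)$; one has $K_{n+1}\ge K_n$ and $u_{n+1}(s)\ge u_n(s)$. Words: $W_n:=\{1,\dots,m\}^n$, $W_0=\{\emptyset\}$, and $W_*:=\bigcup_{n\ge0}W_n$; for $w=i_1\cdots i_n\in W_n$, $|w|=n$ and $\varphi_w:=\varphi_{i_n}\circ\cdots\circ\varphi_{i_1}$ (with $\varphi_\emptyset=\mathrm{id}$). For $s\in X$ and $w\in W_*$ set $$a_s(w):=u_{|w|+1}(\varphi_w(s))-u_{|w|}(\varphi_w(s))\ge0.$$ *)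

(* Defs.v *)
From mathcomp Require Import all_boot all_order all_algebra.
From mathcomp Require Import reals complex.

Set Implicit Arguments.
Unset Strict Implicit.
Unset Printing Implicit Defensive.

Import Order.TTheory GRing.Theory Num.Theory.
Local Open Scope ring_scope.
Local Open Scope complex_scope.

Section Kernels.
Variables (R : realType) (X : Type).
Implicit Types J : X -> X -> R[i].

(* The order on R[i] is partial: 0 <= z means that z is real and nonnegative. *)
Definition positive_definite J : Prop :=
  forall (n : nat) (c : 'I_n -> R[i]) (s : 'I_n -> X),
    0 <= \sum_(a < n) \sum_(b < n) Num.conj (c a) * c b * J (s a) (s b).

Definition kernel_le J1 J2 : Prop :=
  positive_definite (fun s t => J2 s t - J1 s t).

Variables (m : nat) (phi : 'I_m -> X -> X).

Definition pullback J : X -> X -> R[i] :=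
  fun s t => \sum_(i < m) J (phi i s) (phi i t).

Definition kernel_iter (K : X -> X -> R[i]) (n : nat) : X -> X -> R[i] :=
  iter n pullback K.

Definition diag_iter (K : X -> X -> R[i]) (n : nat) (s : X) : R[i] :=
  kernel_iter K n s s.

(* Words are sequences of letters in 'I_m (the alphabet {1, ..., m} shifted to
   {0, ..., m - 1}), and words of length n are n.-tuples.  The first letter of
   the word acts first: [:: i_1; ...; i_n] gives phi i_n \o ... \o phi i_1. *)
Definition word_map (w : seq 'I_m) (s : X) : X :=
  foldl (fun x i => phi i x) s w.

Definition word_gap (K : X -> X -> R[i]) (s : X) (w : seq 'I_m) : R[i] :=
  diag_iter K (size w).+1 (word_map w s) - diag_iter K (size w) (word_map w s).

End Kernels.

(* Main.v *)
Require Import Defs.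
From mathcomp Require Import all_boot all_order all_algebra.
From mathcomp Require Import reals complex.

Set Implicit Arguments.
Unset Strict Implicit.
Unset Printing Implicit Defensive.

(** Unfolding the pullback operator [k] times replaces each point [s] by its
    images under all compositions of [k] of the maps [phi i], so that
    $L^k J (s, t) = \sum_{w \in W_k} J(\varphi_w(s), \varphi_w(t))$
    ([iter_pullback_words]).  Taking $J = K_n$ on the diagonal gives
    $\sum_{w \in W_k} u_n(\varphi_w(s)) = u_{n+k}(s)$.  The two terms of the
    gap at a word of length [k] are the cases $n = k + 1$ and $n = k$, and
    these sum to $u_{2k+1}(s)$ and $u_{2k}(s)$. *)

Import Order.TTheory GRing.Theory Num.Theory.
Local Open Scope ring_scope.
Local Open Scope complex_scope.

Lemma big_tuple_cons (T : finType) (V : nmodType) (k : nat)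
    (F : seq T -> V) :
  \sum_(w : k.+1.-tuple T) F w = \sum_(x : T) \sum_(w : k.-tuple T) F (x :: w).
Proof.
rewrite pair_bigA /=.
rewrite (reindex (fun p : T * k.-tuple T => [tuple of p.1 :: p.2])) //=.
exists (fun w : k.+1.-tuple T => (thead w, [tuple of behead w])).
  by move=> [x w] _; congr pair; apply: val_inj.
by move=> w _; rewrite -tuple_eta.
Qed.

(** The first letter of a word acts first, so it is the summation index of the
    outermost application of [pullback]; peeling that application off moves
    [s] and [t] to their images, so both points vary in the induction. *)
Lemma iter_pullback_words (R : realType) (X : Type) (m : nat)
    (phi : 'I_m -> X -> X) (J : X -> X -> R[i]) (k : nat) (s t : X) :
  iter k (pullback phi) J s t
    = \sum_(w : k.-tuple 'I_m) J (word_map phi w s) (word_map phi w t).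
Proof.
elim: k s t => [|k IHk] s t.
  rewrite (big_pred1 [tuple]) // => w.
  by apply/esym/eqP; exact: tuple0.
rewrite (big_tuple_cons k
  (fun w : seq 'I_m => J (word_map phi w s) (word_map phi w t))) /=.
by apply: eq_bigr => i _; rewrite IHk.
Qed.

Lemma sum_words_diag_iter (R : realType) (X : Type) (m : nat)
    (phi : 'I_m -> X -> X) (K : X -> X -> R[i]) (k n : nat) (s : X) :
  \sum_(w : k.-tuple 'I_m) diag_iter phi K n (word_map phi w s)
    = diag_iter phi K (k + n) s.
Proof. by rewrite /diag_iter /kernel_iter iterD iter_pullback_words. Qed.

Theorem lemma2p8 (R : realType) (X : Type) (m : nat) (phi : 'I_m -> X -> X)
    (K : X -> X -> R[i])
    (m_ge1 : (1 <= m)%N)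
    (K_pd : positive_definite K)
    (K_le : kernel_le K (pullback phi K))
    (s : X) :
  (forall k : nat,
     \sum_(w : k.-tuple 'I_m) word_gap phi K s w
       = diag_iter phi K (2 * k).+1 s - diag_iter phi K (2 * k) s)
  /\
  (forall N : nat, (1 <= N)%N ->
     \sum_(0 <= k < N) \sum_(w : k.-tuple 'I_m) word_gap phi K s w
       = \sum_(0 <= k < N)
           (diag_iter phi K (2 * k).+1 s - diag_iter phi K (2 * k) s)).
Proof.
have gap_sum k : \sum_(w : k.-tuple 'I_m) word_gap phi K s w
    = diag_iter phi K (2 * k).+1 s - diag_iter phi K (2 * k) s.
  rewrite mul2n -addnn -addnS -!sum_words_diag_iter -sumrB.
  by apply: eq_bigr => w _; rewrite /word_gap size_tuple.
by split=> // N _; apply: eq_bigr => k _; exact: gap_sum.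
Qed.
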